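(* Let $H_{a,b}\subset \mathrm{SO}(4)$ be the group $H_{a,b}=\langle [e_a,1],[1,e_b],[1,\mathbf{j}],[\mathbf{j},1]\rangle$ defined in the context. (1) For each odd $m\in\mathbb{N}$ and each decomposition $m=a\cdot b$ with $a,b\ge 3$ odd and $\gcd(a,b)=1$, $H_{a,b}$ is a subgroup of $\mathrm{SO}(4)$ of order $8m$. (2) Let $a,b\geq 3$ be odd with $\gcd(a,b)=1$ and let $b'>b$ be odd and relatively prime to $a$. If $b$ divides $b'$, then $H_{a,b}$ is a subgroup of $H_{a,b'}$. (3) For all odd $a,b\ge 3$ with $\gcd(a,b)=1$, the action of $H_{a,b}$ on $\mathbb{H}\cong\mathbb{R}^4$ is absolutely irreducible. It has precisely two nontrivial isotropy types, and the corresponding fixed point spaces are $2$-dimensional.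
   Context: Let $\mathbb{H}$ be the quaternions with standard basis $1,\mathbf{i},\mathbf{j},\mathbf{k}$, identified with $\mathbb{R}^4$ via $(x_1,x_2,x_3,x_4)\leftrightarrow x_1+\mathbf{i}x_2+\mathbf{j}x_3+\mathbf{k}x_4$. For unit quaternions $l,r$ let $[l,r]\in\mathrm{SO}(4)$ be the linear map $x\mapsto l x\bar r$ of $\mathbb{H}$. Thus $[l,r]=[-l,-r]$ and $[l,r][l',r']=[ll',rr']$. Put $e_p=e^{\pi\mathbf{i}/p}=\cos(\pi/p)+\mathbf{i}\sin(\pi/p)$. For odd $a,b\ge 3$ with $\gcd(a,b)=1$ let $H_{a,b}$ be the group generated by $[e_a,1],[1,e_b],[1,\mathbf{j}],[\mathbf{j},1]$; it acts on $\mathbb{H}$ by these maps. A real representation is absolutely irreducible if the only linear maps commuting with the group action are real multiples of the identity. The isotropy subgroup of a point $x$ is its stabilizer; an isotropy type is a conjugacy class of isotropy subgroups. It is nontrivial if the subgroups in it are neither the trivial group nor the whole group. The fixed point space of a subgroup $K$ is $\mathrm{Fix}(K)=\{x: kx=x \text{ for all } k\in K\}$. *)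

(* Defs.v *)
From mathcomp Require Import all_boot all_order all_algebra.
From mathcomp Require Import boolp classical_sets functions cardinality.
From mathcomp Require Import reals trigo.
From mathcomp Require Import ring.

Set Implicit Arguments.
Unset Strict Implicit.
Unset Printing Implicit Defensive.

Import Order.TTheory GRing.Theory Num.Theory.
Local Open Scope classical_set_scope.
Local Open Scope ring_scope.

Section MatrixGroups.
Variables (R : realType) (n : nat).
Implicit Types (G K S : set 'M[R]_n) (A B : 'M[R]_n) (x : 'cV[R]_n).

Definition matrix_group G : Prop :=
  [/\ G `<=` [set A | A \in unitmx], G 1%:M,
      forall A B, G A -> G B -> G (A *m B)
    & forall A, G A -> G (invmx A)].

Definition subgroup K G : Prop := [/\ matrix_group K, matrix_group G & K `<=` G].

(* To be used only when S consists of invertible matrices: otherwise no matrix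
   group contains S and the intersection is the set of all matrices. *)
Definition generated S : set 'M[R]_n := smallest matrix_group S.

Definition SO : set 'M[R]_n := [set A | A *m A^T = 1%:M /\ \det A = 1].

(* A matrix A acts on column vectors by x |-> A *m x. *)

Definition abs_irreducible G : Prop :=
  forall f : {linear 'cV[R]_n -> 'cV[R]_n},
    (forall A, G A -> forall x, f (A *m x) = A *m f x) ->
    exists c : R, forall x, f x = c *: x.

Definition isotropy_subgroup G x : set 'M[R]_n := [set A | G A /\ A *m x = x].

Definition conjugacy_class G K : set (set 'M[R]_n) :=
  [set [set A *m B *m invmx A | B in K] | A in G].

Definition isotropy_types G : set (set (set 'M[R]_n)) :=
  [set conjugacy_class G (isotropy_subgroup G x) | x in setT].

Definition nontrivial_isotropy_types G : set (set (set 'M[R]_n)) :=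
  [set T | isotropy_types G T /\
           forall K, T K -> K <> [set 1%:M] /\ K <> G].

Definition Fix K : set 'cV[R]_n := [set x | forall A, K A -> A *m x = x].

Definition is_subspace_of_dim (X : set 'cV[R]_n) (d : nat) : Prop :=
  exists2 V : {vspace 'cV[R]_n}, X = [set x | x \in V] & \dim V = d.

End MatrixGroups.

Arguments SO R n : clear implicits.

Section Quaternions.
Variable R : realType.
Local Notation H := 'cV[R]_4.
Implicit Types x y l r : H.

(* The quaternion x1 + i x2 + j x3 + k x4 is the column (x1, x2, x3, x4)^T. *)
Definition quat (x1 x2 x3 x4 : R) : H := \col_i [:: x1; x2; x3; x4]`_i.

Definition qmul x y : H :=
  let x1 := x 0 0 in let x2 := x 1 0 in let x3 := x 2 0 in let x4 := x 3 0 in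
  let y1 := y 0 0 in let y2 := y 1 0 in let y3 := y 2 0 in let y4 := y 3 0 in
  quat (x1 * y1 - x2 * y2 - x3 * y3 - x4 * y4)
       (x1 * y2 + x2 * y1 + x3 * y4 - x4 * y3)
       (x1 * y3 - x2 * y4 + x3 * y1 + x4 * y2)
       (x1 * y4 + x2 * y3 - x3 * y2 + x4 * y1).

Definition qconj x : H := quat (x 0 0) (- x 1 0) (- x 2 0) (- x 3 0).

Definition q1 : H := quat 1 0 0 0.
Definition qi : H := quat 0 1 0 0.
Definition qj : H := quat 0 0 1 0.
Definition qk : H := quat 0 0 0 1.

Definition qe (p : nat) : H := quat (cos (pi / p%:R)) (sin (pi / p%:R)) 0 0.

(* [l, r], the matrix of x |-> l x r^* (see qrotE). *)
Definition qrot l r : 'M[R]_4 :=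
  \matrix_(i, j) qmul (qmul l (delta_mx j 0)) (qconj r) i 0.

Definition H_ (a b : nat) : set 'M[R]_4 :=
  generated [set A | [\/ A = qrot (qe a) q1, A = qrot q1 (qe b),
                         A = qrot q1 qj | A = qrot qj q1]].

Lemma qrotE l r x : qrot l r *m x = qmul (qmul l x) (qconj r).
Proof.
have xE : x = \col_i [:: x 0 0; x 1 0; x 2 0; x 3 0]`_i.
  apply/matrixP => i j; rewrite ord1 mxE.
  by case: i => -[|[|[|[|//]]]] Hi /=; congr (x _ _); exact: val_inj.
rewrite xE; move: (x 0 0) (x 1 0) (x 2 0) (x 3 0) => x1 x2 x3 x4 {xE}.
apply/matrixP => i j; rewrite ord1 {j} /qrot /qmul /qconj /quat !mxE !big_ord_recl big_ord0.
by case: i => -[|[|[|[|//]]]] Hi; rewrite !mxE /=; ring.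
Qed.

Lemma qmul_ij : qmul qi qj = qk.
Proof.
apply/matrixP => i j; rewrite ord1 /qmul /qi /qj /qk /quat !mxE.
by case: i => -[|[|[|[|//]]]] Hi; rewrite /=; ring.
Qed.

End Quaternions.

Arguments H_ R a b : clear implicits.

(* Main.v *)
Require Import Defs.
From mathcomp Require Import all_boot all_order all_algebra.
From mathcomp Require Import boolp classical_sets functions cardinality.
From mathcomp Require Import reals trigo.
From mathcomp Require Import ring lra zify.

Set Implicit Arguments.
Unset Strict Implicit.
Unset Printing Implicit Defensive.

Import Order.TTheory GRing.Theory Num.Theory.
Local Open Scope classical_set_scope.
Local Open Scope ring_scope.
Local Open Scope card_scope.

(** The group [H_ R a b] is the image in [SO(4)] of a product of two dicyclic
    groups: the left factors are the [4 a] quaternions [e_a^s] and [e_a^s j], the right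
    factors the [4 b] quaternions [e_b^t] and [e_b^t j]. These products are closed
    under multiplication and inverses and come from the generators
    ([H_dic_pairs]), and two pairs [(l, r)] give the same map only if they differ
    by a common sign ([qrot_inj]). Hence the order is [4 a * 4 b / 2 = 8 a b]
    ([card_H]). The maps have determinant 1 because every unit quaternion is a
    square ([det_qrot]), and if [b] divides [b'] then [e_b] is a power of [e_b'].

    Since [sin (pi / a)] and [sin (pi / b)] do not vanish, a linear map that
    commutes with the group commutes with left and right multiplication by [i] and
    [j]; it is then multiplication by a central quaternion, that is, by a real
    number ([abs_irreducible_H]).

    For the isotropy groups, [x |-> l x r^*] fixes [x <> 0] iff [l x = x r], so [l]
    and [r] are conjugate quaternions; in particular [l^n = 1] iff [r^n = 1], and
    likewise for [-1].
    - If [l] and [r] are powers of [e_a] and [e_b], coprimality of [a] and [b]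
      leaves only [l = r = 1] or [l = r = -1], the identity ([cyclic_fix]).
    - If exactly one of them lies in the coset of [j], its square is [-1], whereas
      an even power of [e_a] or [e_b] is never [-1], as [a] and [b] are odd.
    - The remaining elements [qrot (e_a^s j) (e_b^t j)] are involutions.
    A product of two maps of the last kind is of the first kind, so a nontrivial
    isotropy group of a nonzero point consists of the identity and one involution
    ([isotropy_unique]). Conjugation by [qrot (e_a^m) (e_b^n)] changes [s] and [t]
    by [2 m] and [2 n]; as [a] and [b] are odd, every involution becomes
    [qrot j j] or [qrot j (- j)] ([flip_conj]), which fix the planes spanned by
    [1, j] and by [i, k]. The parity of [s + t] separates these two classes
    ([flip_not_conj]). *)

(** * Quaternions *)

Section QuaternionAlgebra.
Variable R : realType.
Local Notation H := 'cV[R]_4.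
Implicit Types (x y z l r : H) (c : R).

Lemma quat_eta x : x = quat (x 0 0) (x 1 0) (x 2 0) (x 3 0).
Proof.
apply/matrixP => i j; rewrite ord1 mxE.
by case: i => -[|[|[|[|//]]]] Hi /=; congr (x _ _); exact: val_inj.
Qed.

Lemma quat0 a b c d : @quat R a b c d 0 0 = a. Proof. by rewrite mxE. Qed.
Lemma quat1 a b c d : @quat R a b c d 1 0 = b. Proof. by rewrite mxE. Qed.
Lemma quat2 a b c d : @quat R a b c d 2 0 = c. Proof. by rewrite mxE. Qed.
Lemma quat3 a b c d : @quat R a b c d 3 0 = d. Proof. by rewrite mxE. Qed.
Definition quatE := (quat0, quat1, quat2, quat3).

Lemma quatD a b c d a' b' c' d' :
  quat a b c d + quat a' b' c' d' =
  quat (a + a') (b + b') (c + c') (d + d') :> H.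
Proof.
apply/matrixP => i j; rewrite !mxE.
by case: i => -[|[|[|[|//]]]].
Qed.

Lemma quatN a b c d : - quat a b c d = quat (- a) (- b) (- c) (- d) :> H.
Proof.
apply/matrixP => i j; rewrite !mxE.
by case: i => -[|[|[|[|//]]]].
Qed.

Lemma quatZ e a b c d :
  e *: quat a b c d = quat (e * a) (e * b) (e * c) (e * d) :> H.
Proof.
apply/matrixP => i j; rewrite !mxE.
by case: i => -[|[|[|[|//]]]].
Qed.

Ltac qring :=
  rewrite /qmul /qconj /q1 /qi /qj /qk ?(quatE, quatD, quatN, quatZ);
  congr quat; ring.

Lemma quat_inj a b c d a' b' c' d' :
  quat a b c d = quat a' b' c' d' :> H ->
  [/\ a = a', b = b', c = c' & d = d'].
Proof.
by move=> E; split; [have := congr1 (fun x : H => x 0 0) E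
  | have := congr1 (fun x : H => x 1 0) E
  | have := congr1 (fun x : H => x 2 0) E
  | have := congr1 (fun x : H => x 3 0) E]; rewrite !quatE.
Qed.

Lemma qmulA x y z : qmul x (qmul y z) = qmul (qmul x y) z.
Proof. by qring. Qed.

Lemma qmul1l x : qmul (q1 R) x = x.
Proof. by rewrite [RHS]quat_eta; qring. Qed.

Lemma qmul1r x : qmul x (q1 R) = x.
Proof. by rewrite [RHS]quat_eta; qring. Qed.

Lemma qmulNl x y : qmul (- x) y = - qmul x y.
Proof. by rewrite (quat_eta x); qring. Qed.

Lemma qmulNr x y : qmul x (- y) = - qmul x y.
Proof. by rewrite (quat_eta y); qring. Qed.

Lemma qconjM x y : qconj (qmul x y) = qmul (qconj y) (qconj x).
Proof. by qring. Qed.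

Lemma qconjN x : qconj (- x) = - qconj x.
Proof. by rewrite (quat_eta x); qring. Qed.

Lemma qconjK x : qconj (qconj x) = x.
Proof. by rewrite [RHS]quat_eta; qring. Qed.

Lemma qconj1 : qconj (q1 R) = q1 R.
Proof. by qring. Qed.

Definition qunit x := qmul x (qconj x) = q1 R.

Definition qnorm2 x : R := x 0 0 ^+ 2 + x 1 0 ^+ 2 + x 2 0 ^+ 2 + x 3 0 ^+ 2.

Lemma qmul_qconj x : qmul x (qconj x) = qnorm2 x *: q1 R.
Proof. by rewrite /qnorm2; qring. Qed.

Lemma qconj_qmul x : qmul (qconj x) x = qnorm2 x *: q1 R.
Proof. by rewrite /qnorm2; qring. Qed.

Lemma qunitE x : qunit x <-> qnorm2 x = 1.
Proof.
rewrite /qunit qmul_qconj /q1 quatZ; split=> [/quat_inj[+ _ _ _]|->].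
  by rewrite mulr1.
by qring.
Qed.

Lemma qunitVl x : qunit x -> qmul (qconj x) x = q1 R.
Proof. by move=> /qunitE xu; rewrite qconj_qmul xu scale1r. Qed.

Lemma qunit_conj x : qunit x -> qunit (qconj x).
Proof. by move=> xu; rewrite /qunit qconjK qunitVl. Qed.

Lemma qunit1 : qunit (q1 R).
Proof. by rewrite /qunit qconj1 qmul1l. Qed.

Lemma qnorm2_eq0 x : qnorm2 x = 0 -> x = 0.
Proof.
rewrite [x]quat_eta /qnorm2 !quatE.
move: (x 0 0) (x 1 0) (x 2 0) (x 3 0) => a b c d abcd0.
have [-> -> -> ->] : [/\ a = 0, b = 0, c = 0 & d = 0].
  by split; apply/eqP; rewrite -sqrf_eq0; apply/eqP; nra.
by rewrite -[RHS](scale0r (quat 0 0 0 0)) quatZ mulr0.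
Qed.

Lemma qnorm2_neq0 x : x <> 0 -> qnorm2 x != 0.
Proof. by move=> x0; apply/eqP => /qnorm2_eq0. Qed.

(** The real part is symmetric, [Re (y z) = Re (z y)], so conjugate quaternions have
    the same one. *)
Lemma qre_intertwined l r x : x <> 0 -> qmul l x = qmul x r -> l 0 0 = r 0 0.
Proof.
move=> /qnorm2_neq0 x0 E; apply: (mulIf x0).
have -> : l 0 0 * qnorm2 x = qmul (qmul l x) (qconj x) 0 0.
  by rewrite -qmulA qmul_qconj /qmul /q1 quatZ !quatE; ring.
by rewrite E /qmul /qconj /qnorm2 !quatE; ring.
Qed.

(** [- 1] is the square of [i]; otherwise the line through [1 + l] bisects the
    angle between [1] and [l]. *)
Lemma qunit_square l : qunit l -> exists2 h, qunit h & l = qmul h h.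
Proof.
move=> /qunitE lu.
have [l1|l1] := eqVneq (l 0 0) (-1).
  exists (qi R); first by rewrite qunitE /qnorm2 !quatE; ring.
  move: lu; rewrite [l]quat_eta /qnorm2 l1 !quatE.
  move: (l 1 0) (l 2 0) (l 3 0) => b c d bcd.
  have [-> -> ->] : [/\ b = 0, c = 0 & d = 0].
    by split; apply/eqP; rewrite -sqrf_eq0; apply/eqP; nra.
  by qring.
have re_gt : 0 < 2 * (1 + l 0 0).
  have : -1 <= l 0 0 by move: lu; rewrite /qnorm2; nra.
  by rewrite le_eqVlt eq_sym (negPf l1) /=; lra.
set s := 2 * (1 + l 0 0) in re_gt.
have ss : Num.sqrt s ^- 2 * s = 1.
  by rewrite sqr_sqrtr ?mulVf ?lt0r_neq0 // ltW.
set u := Num.sqrt s in ss.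
have lE := quat_eta l; move: lu ss; rewrite lE /s /qnorm2 !quatE.
move: (l 0 0) (l 1 0) (l 2 0) (l 3 0) => a b c d lu su.
have {}lu : d ^+ 2 = 1 - a ^+ 2 - b ^+ 2 - c ^+ 2 by rewrite -lu; ring.
exists (u^-1 *: quat (1 + a) b c d).
  apply/qunitE; rewrite -[RHS]su quatZ /qnorm2 !quatE.
  have -> : 2 * (1 + a) = (1 + a) ^+ 2 + b ^+ 2 + c ^+ 2 + d ^+ 2.
    by ring: lu.
  by rewrite -exprVn; ring.
have v2 : u^-1 * u^-1 * (2 * (1 + a)) = 1 by rewrite -[RHS]su -expr2 -exprVn.
rewrite quatZ /qmul !quatE; congr quat.
- by rewrite -[LHS]mul1r -[X in X * _]v2; ring: lu.
- by rewrite -[LHS]mul1r -[X in X * _]v2; ring.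
- by rewrite -[LHS]mul1r -[X in X * _]v2; ring.
- by rewrite -[LHS]mul1r -[X in X * _]v2; ring.
Qed.

End QuaternionAlgebra.

(** * The maps x |-> l x r^* *)

Section Rotations.
Variable R : realType.
Local Notation H := 'cV[R]_4.
Implicit Types (x y l r : H) (A B : 'M[R]_4).

Lemma mulmx_ext A B : (forall x : H, A *m x = B *m x) -> A = B.
Proof.
move=> AB; apply/matrixP => i j.
by have /matrixP/(_ i 0) := AB (delta_mx j 0); rewrite -!colE !mxE.
Qed.

Lemma qrotM l r l' r' :
  qrot l r *m qrot l' r' = qrot (qmul l l') (qmul r r').
Proof. by apply: mulmx_ext => x; rewrite -mulmxA !qrotE qconjM !qmulA. Qed.

Lemma qrot1 : qrot (q1 R) (q1 R) = 1%:M.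
Proof.
by apply: mulmx_ext => x; rewrite qrotE mul1mx qconj1 qmul1l qmul1r.
Qed.

Lemma qrotNN l r : qrot (- l) (- r) = qrot l r.
Proof.
by apply: mulmx_ext => x; rewrite !qrotE qconjN qmulNr !qmulNl opprK.
Qed.

Lemma qrotNr l r : qrot l (- r) = - qrot l r.
Proof. by apply: mulmx_ext => x; rewrite mulNmx !qrotE qconjN qmulNr. Qed.

Lemma qrotVr l r : qunit l -> qunit r ->
  qrot l r *m qrot (qconj l) (qconj r) = 1%:M.
Proof. by move=> lu ru; rewrite qrotM lu ru qrot1. Qed.

Lemma qrot_unit l r : qunit l -> qunit r -> qrot l r \in unitmx.
Proof. by move=> lu ru; case/mulmx1_unit: (qrotVr lu ru). Qed.

Lemma invmx_qrot l r : qunit l -> qunit r ->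
  invmx (qrot l r) = qrot (qconj l) (qconj r).
Proof.
move=> lu ru; rewrite -[LHS]mulmx1 -(qrotVr lu ru) mulmxA mulVmx ?mul1mx //.
exact: qrot_unit.
Qed.

Lemma qrot_fix l r x : qunit r ->
  qrot l r *m x = x <-> qmul l x = qmul x r.
Proof.
move=> ru; rewrite qrotE; split=> [E|->].
  by rewrite -[in RHS]E -qmulA qunitVl // qmul1r.
by rewrite -qmulA ru qmul1r.
Qed.

Lemma qrot_fix_re l r x : qunit r -> x <> 0 -> qrot l r *m x = x ->
  l 0 0 = r 0 0.
Proof. by move=> ru x0 /(qrot_fix _ _ ru) /(qre_intertwined x0). Qed.

Lemma trmx_qrot l r : (qrot l r)^T = qrot (qconj l) (qconj r).
Proof.
apply/matrixP => i j; rewrite /qrot /qmul /qconj /quat !mxE.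
case: i => -[|[|[|[|//]]]] Hi; case: j => -[|[|[|[|//]]]] Hj;
  rewrite /= ?mxE /=; ring.
Qed.

Lemma qrot_orthogonal l r : qunit l -> qunit r ->
  qrot l r *m (qrot l r)^T = 1%:M.
Proof. by move=> lu ru; rewrite trmx_qrot qrotVr. Qed.

(** Unit quaternions are squares, so [qrot l r] is the square of an orthogonal
    matrix, whose determinant is a sign. *)
Lemma det_qrot l r : qunit l -> qunit r -> \det (qrot l r) = 1.
Proof.
move=> /qunit_square[h hu ->] /qunit_square[k ku ->].
by rewrite -qrotM det_mulmx -{2}det_tr -det_mulmx qrot_orthogonal // det1.
Qed.

Lemma qrot_SO l r : qunit l -> qunit r -> SO R 4 (qrot l r).
Proof. by move=> lu ru; split; [exact: qrot_orthogonal | exact: det_qrot]. Qed.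

(** If [l x = x r] for every [x], then [x = 1] gives [l = r], and a quaternion
    that commutes with [i] and [j] is real. *)
Lemma qrot_eq1 l r : qunit l -> qunit r -> qrot l r = 1%:M ->
  l = r /\ (l = q1 R \/ l = - q1 R).
Proof.
move=> lu ru E.
have fix_all x : qmul l x = qmul x r by apply/qrot_fix; rewrite ?E ?mul1mx.
have lr : l = r by have := fix_all (q1 R); rewrite qmul1l qmul1r.
split=> //; move: lu; rewrite -{}lr {r ru E} in fix_all *.
move: fix_all; rewrite qunitE [l]quat_eta.
move: (l 0 0) (l 1 0) (l 2 0) (l 3 0) => a b c d {l} comm.
have /quat_inj[_ _ ci di] := comm (qi R).
have /quat_inj[_ bj _ dj] := comm (qj R).
move: ci di bj dj; rewrite /qi /qj !quatE /q1 quatN /qnorm2 !quatE.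
move=> ci di bj dj norm1.
have b0 : b = 0 by lra.
have c0 : c = 0 by lra.
have d0 : d = 0 by lra.
have /eqP : (a - 1) * (a + 1) = 0 by subst; rewrite -[RHS](subrr 1) -{3}norm1; ring.
rewrite mulf_eq0 => /orP[] /eqP a1; [left | right].
- by congr quat; lra.
- by congr quat; lra.
Qed.

(** The quotient of the two maps is [qrot] of the quotients, to which [qrot_eq1]
    applies. *)
Lemma qrot_inj l r l' r' :
  qunit l -> qunit r -> qunit l' -> qunit r' -> qrot l r = qrot l' r' ->
  (l = l' /\ r = r') \/ (l = - l' /\ r = - r').
Proof.
move=> lu ru lu' ru' E.
have : qrot (qmul (qconj l') l) (qmul (qconj r') r) = 1%:M.
  rewrite -qrotM E qrotM !qunitVl // qrot1 //.
have unitM x y : qunit x -> qunit y -> qunit (qmul x y).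
  by move=> xu yu; rewrite /qunit qconjM qmulA -(qmulA x) yu qmul1r.
move=> /qrot_eq1[||lr l1]; try by apply: unitM => //; exact: qunit_conj.
have back x y z : qunit x -> qmul (qconj x) y = z -> y = qmul x z.
  by move=> xu <-; rewrite qmulA xu qmul1l.
case: l1 => l1; rewrite l1 in lr; move/(back _ _ _ lu'): l1 => ->;
  move/esym/(back _ _ _ ru'): lr => ->; rewrite ?qmulNr !qmul1r; by [left|right].
Qed.

End Rotations.

(** * Dicyclic groups of unit quaternions *)

Section Dicyclic.
Variable R : realType.
Local Notation H := 'cV[R]_4.

Definition angle (p : nat) (n : int) : R := n%:~R * (pi / p%:R).

(** The dicyclic group of order [4 p]: [dic p e n] is [e_p^n] if [e] is false and
    [e_p^n j = cos j + sin k] if [e] is true. Integer exponents, rather than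
    residues modulo [2 p], keep the group law polynomial in the exponents. *)
Definition dic (p : nat) (e : bool) (n : int) : H :=
  let c := cos (angle p n) in let s := sin (angle p n) in
  if e then quat 0 0 c s else quat c s 0 0.

Lemma angleD p (m n : int) : angle p (m + n) = angle p m + angle p n.
Proof. by rewrite /angle intrD mulrDl. Qed.

Lemma angleN p (n : int) : angle p (- n) = - angle p n.
Proof. by rewrite /angle intrN mulNr. Qed.

Lemma angle0 p : angle p 0 = 0. Proof. by rewrite /angle mul0r. Qed.

Lemma angle_half_turn p : (0 < p)%N -> angle p p%:Z = pi.
Proof. by move=> p0; rewrite /angle mulrCA divff ?mulr1 // pnatr_eq0 -lt0n. Qed.

Lemma dic0 p : dic p false 0 = q1 R.
Proof. by rewrite /dic angle0 cos0 sin0. Qed.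

Lemma dic_j p : dic p true 0 = qj R.
Proof. by rewrite /dic angle0 cos0 sin0. Qed.

Lemma dic_qe p : dic p false 1 = qe R p.
Proof. by rewrite /dic /angle mul1r. Qed.

Lemma dic_add_half p e (n : int) : (0 < p)%N -> dic p e (n + p%:Z) = - dic p e n.
Proof.
move=> p0; rewrite /dic angleD angle_half_turn // cosDpi sinDpi.
by case: e; rewrite quatN ?oppr0.
Qed.

(** From [j e_p^n = e_p^(- n) j] and [j^2 = -1 = e_p^p]. *)
Lemma dicM p e (m : int) e' (n : int) : (0 < p)%N ->
  qmul (dic p e m) (dic p e' n) =
  dic p (e (+) e') (m + (if e then - n else n) + (if e && e' then p%:Z else 0)).
Proof.
move=> p0; case: e e' => -[] /=; rewrite ?addr0 /dic /=;
rewrite !angleD ?angleN ?angle_half_turn // ?cosDpi ?sinDpi cosD sinD ?cosN ?sinN;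
rewrite /qmul !quatE; congr quat; ring.
Qed.

Lemma dicC p e (n : int) : (0 < p)%N ->
  qconj (dic p e n) = dic p e (if e then n + p%:Z else - n).
Proof.
move=> p0; case: e; rewrite ?dic_add_half // /dic /= ?quatN ?angleN ?cosN ?sinN;
rewrite /qconj !quatE; congr quat; ring.
Qed.

Lemma dic_unit p e n : qunit (dic p e n).
Proof.
apply/qunitE; rewrite -[RHS](cos2Dsin2 (angle p n)) /dic /qnorm2.
by case: e; rewrite !quatE; ring.
Qed.

(** Adding [q p] to an exponent multiplies by [(-1)^q]; when both factors change
    sign together, the map stays the same. *)
Lemma qrot_dic_shift a b e (s : int) d (t q : int) : (0 < a)%N -> (0 < b)%N ->
  qrot (dic a e (s + q * a%:Z)) (dic b d (t + q * b%:Z)) =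
  qrot (dic a e s) (dic b d t).
Proof.
move=> a0 b0.
have pos (n : nat) s' t' :
    qrot (dic a e (s' + n%:Z * a%:Z)) (dic b d (t' + n%:Z * b%:Z)) =
    qrot (dic a e s') (dic b d t').
  elim: n => [|n IH]; first by rewrite !mul0r !addr0.
  have -> : s' + n.+1%:Z * a%:Z = s' + n%:Z * a%:Z + a%:Z by rewrite intS; ring.
  have -> : t' + n.+1%:Z * b%:Z = t' + n%:Z * b%:Z + b%:Z by rewrite intS; ring.
  by rewrite !dic_add_half // qrotNN.
case: q => n; first exact: pos.
rewrite -[LHS](pos n.+1) NegzE; congr (qrot (dic _ _ _) (dic _ _ _)); ring.
Qed.

Lemma dic_period p e (n q : int) : (0 < p)%N ->
  dic p e (n + q * (2 * p%:Z)) = dic p e n.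
Proof.
move=> p0.
have pos (k : nat) n' : dic p e (n' + k%:Z * (2 * p%:Z)) = dic p e n'.
  elim: k => [|k IH]; first by rewrite mul0r addr0.
  have -> : n' + k.+1%:Z * (2 * p%:Z) = n' + k%:Z * (2 * p%:Z) + p%:Z + p%:Z.
    by rewrite intS; ring.
  by rewrite !dic_add_half // opprK.
case: q => k; first exact: pos.
by rewrite -[LHS](pos k.+1) NegzE; congr dic; ring.
Qed.

(** Reduce [n] to its residue [r] modulo [2 p]: if [r] is nonzero, then half the
    angle lies strictly between [0] and [pi], where [sin] is positive, and
    [cos x = 1 - 2 sin^2 (x / 2)]. *)
Lemma cos_angle_eq1 p (n : int) : (0 < p)%N -> cos (angle p n) = 1 ->
  (((2 * p)%N : int) %| n)%Z.
Proof.
move=> p0; rewrite [in cos _](divz_eq n (2 * p)%N%:Z).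
set r := (n %% _)%Z; have r_ge0 : 0 <= r by rewrite modz_ge0; lia.
have r_lt : r < (2 * p)%N%:Z by rewrite ltz_pmod; lia.
have -> : cos (angle p ((n %/ (2 * p)%N%:Z)%Z * (2 * p)%N%:Z + r)) = cos (angle p r).
  have := congr1 (fun x : H => x 0 0) (dic_period false r (n %/ (2 * p)%N%:Z)%Z p0).
  by rewrite /dic !quatE => <-; congr (cos (angle _ _)); rewrite PoszM addrC.
move=> cos1; apply/dvdz_mod0P; rewrite -/r.
apply: contra_eq cos1 => r_neq0.
have p_gt0 : 0 < p%:R :> R by rewrite ltr0n.
have half : angle p r = (angle p r / 2) *+ 2 by rewrite -mulr_natr divfK ?pnatr_eq0.
have : 0 < sin (angle p r / 2).
  apply: sin_gt0_pi; rewrite /angle; apply/andP; split.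
    have r_gt0 : 0 < r%:~R :> R by rewrite ltr0z; lia.
    by rewrite divr_gt0 // mulr_gt0 // divr_gt0 ?pi_gt0.
  rewrite ltr_pdivrMr // mulrCA ltr_pM2l ?pi_gt0 // ltr_pdivrMr //.
  by rewrite -natrM -[X in _ < X]/((2 * p)%N%:~R) ltr_int.
move=> sin0; rewrite half cos_mulr2n.
apply/eqP => cos1; have := cos2Dsin2 (angle p r / 2).
move: sin0 cos1; move: (sin _) (cos _) => s c s0 c1 cs1.
by have : 0 < s * s by [exact: mulr_gt0]; lra.
Qed.

Lemma dic_eq1 p (n : int) : cos (angle p n) = 1 -> dic p false n = q1 R.
Proof.
move=> c1; have := cos2Dsin2 (angle p n); rewrite /dic c1 expr1n.
move=> /(canRL (addKr _)); rewrite addNr => /eqP; rewrite sqrf_eq0 => /eqP ->.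
by [].
Qed.

Lemma dic_inj p e (m : int) e' (n : int) : (0 < p)%N -> dic p e m = dic p e' n ->
  e = e' /\ (((2 * p)%N : int) %| m - n)%Z.
Proof.
move=> p0 E.
have ee' : e = e'.
  have := cos2Dsin2 (angle p m); move: E.
  case: e e' => -[] //= /quat_inj[c0 s0 c1 s1].
    by rewrite c1 s1 !expr0n addr0 => /eqP; rewrite eq_sym oner_eq0.
  by rewrite c0 s0 !expr0n addr0 => /eqP; rewrite eq_sym oner_eq0.
split=> //; subst e'; apply: cos_angle_eq1 => //.
rewrite angleD angleN cosB -[RHS](cos2Dsin2 (angle p n)).
by case: e E => /quat_inj[] /= => [_ _ -> ->|-> -> _ _]; rewrite -!expr2.
Qed.

End Dicyclic.

Arguments dic R p e n : simpl never.

(** * Elements and order of the group *)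

Section TheGroup.
Variables (R : realType) (a b : nat).
Hypotheses (a_gt0 : (0 < a)%N) (b_gt0 : (0 < b)%N).

Definition dic_pairs : set 'M[R]_4 :=
  [set A | exists e s d t, A = qrot (dic R a e s) (dic R b d t)].

Lemma dic_pairs_qrot e s d t : dic_pairs (qrot (dic R a e s) (dic R b d t)).
Proof. by exists e, s, d, t. Qed.

Lemma matrix_group_dic_pairs : matrix_group dic_pairs.
Proof.
split.
- by move=> _ [e [s [d [t ->]]]]; apply: qrot_unit; exact: dic_unit.
- by rewrite -qrot1 -{1}(dic0 R a) -(dic0 R b); exact: dic_pairs_qrot.
- move=> _ _ [e [s [d [t ->]]]] [e' [s' [d' [t' ->]]]].
  by rewrite qrotM !dicM //; exact: dic_pairs_qrot.
- move=> _ [e [s [d [t ->]]]].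
  rewrite invmx_qrot ?dicC //; try exact: dic_unit.
  exact: dic_pairs_qrot.
Qed.

(** The generators are dicyclic pairs. Conversely [e_a^s j^e] and [e_b^t j^d] are
    products of generators, the powers with negative exponent being inverses. *)
Lemma H_dic_pairs : H_ R a b = dic_pairs.
Proof.
apply/seteqP; split.
  apply: smallest_sub; first exact: matrix_group_dic_pairs.
  move=> _ [] ->.
  - by rewrite -dic_qe -(dic0 R b); exact: dic_pairs_qrot.
  - by rewrite -dic_qe -(dic0 R a); exact: dic_pairs_qrot.
  - by rewrite -(dic_j R b) -(dic0 R a); exact: dic_pairs_qrot.
  - by rewrite -(dic_j R a) -(dic0 R b); exact: dic_pairs_qrot.
move=> _ [e [s [d [t ->]]]] M [[unitM M1 mulM invM] genM].
have u1 := qunit1 R.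
have split_dic p e' n : (0 < p)%N ->
    dic R p e' n = qmul (dic R p false n) (dic R p e' 0).
  by move=> p0; rewrite dicM //= !addr0.
have Ml (s' : int) : M (qrot (dic R a false s') (q1 R)).
  have Mpos (n : nat) : M (qrot (dic R a false n) (q1 R)).
    elim: n => [|n IH]; first by rewrite dic0 qrot1.
    rewrite intS -[_ + _]addr0 -(dicM R false _ false) // -(qmul1l (q1 R)).
    by rewrite -qrotM; apply: mulM => //; apply: genM; rewrite dic_qe; constructor.
  case: s' => // n; rewrite NegzE -(dicC R false) // -qconj1.
  by rewrite -invmx_qrot //; [exact: invM | exact: dic_unit].
have Mr (t' : int) : M (qrot (q1 R) (dic R b false t')).
  have Mpos (n : nat) : M (qrot (q1 R) (dic R b false n)).
    elim: n => [|n IH]; first by rewrite dic0 qrot1.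
    rewrite intS -[_ + _]addr0 -(dicM R false _ false) // -(qmul1l (q1 R)).
    by rewrite -qrotM; apply: mulM => //; apply: genM; rewrite dic_qe; constructor.
  case: t' => // n; rewrite NegzE -(dicC R false) // -qconj1.
  by rewrite -invmx_qrot //; [exact: invM | exact: dic_unit].
have Mlj : M (qrot (dic R a e 0) (q1 R)).
  by case: e; [apply: genM; rewrite dic_j; constructor | exact: Ml].
have Mrj : M (qrot (q1 R) (dic R b d 0)).
  by case: d; [apply: genM; rewrite dic_j; constructor | exact: Mr].
have -> : qrot (dic R a e s) (dic R b d t) =
    qrot (dic R a false s) (q1 R) *m qrot (dic R a e 0) (q1 R) *m
    (qrot (q1 R) (dic R b false t) *m qrot (q1 R) (dic R b d 0)).
  by rewrite !qrotM -!split_dic // !(qmul1l, qmul1r).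
by apply: (mulM); apply: mulM.
Qed.

Lemma matrix_group_H : matrix_group (H_ R a b).
Proof. by rewrite H_dic_pairs; exact: matrix_group_dic_pairs. Qed.

Lemma dvdz_small (m n : int) : (m %| n)%Z -> (`|n| < `|m|)%N -> n = 0.
Proof.
rewrite dvdzE => mn lt_nm; apply/eqP; rewrite -absz_eq0 -leqn0 leqNgt.
by apply/negP => /dvdn_leq /(_ mn); rewrite leqNgt lt_nm.
Qed.

(** A common sign change of the two factors normalises the exponent of the
    left factor to [0 <= s < a]; then [t] is determined modulo [2 b]. *)
Lemma card_H : H_ R a b #= `I_(8 * (a * b)).
Proof.
pose T := (('I_a * bool) * ('I_(2 * b) * bool))%type.
pose f (x : T) : 'M[R]_4 :=
  qrot (dic R a x.1.2 (x.1.1 : nat)%:Z) (dic R b x.2.2 (x.2.1 : nat)%:Z).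
have f_inj : injective f.
  move=> [[s e] [t d]] [[s' e'] [t' d']]; rewrite /f /=.
  move=> /qrot_inj[||||[]|[]]; try exact: dic_unit.
    move=> /dic_inj[] // -> ss /dic_inj[] // -> tt.
    have := ltn_ord s; have := ltn_ord s'; have := ltn_ord t; have := ltn_ord t'.
    move=> ? ? ? ?.
    congr (_, _, (_, _)); apply/val_inj => /=; apply/eqP; rewrite -eqz_nat -subr_eq0.
    - by apply/eqP/(dvdz_small ss); lia.
    - by apply/eqP/(dvdz_small tt); lia.
  (* A common sign would need [s = s' + a] modulo [2 a], but [|s - s'| < a]. *)
  rewrite -dic_add_half // => /dic_inj[] // _ /dvdz_small ss _.
  have := ltn_ord s; have := ltn_ord s' => ? ?.
  by have := ss ltac:(lia); lia.
have H_image : H_ R a b = [set f (enum_val i) | i in [set: 'I_#|{: T}|]].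
  rewrite H_dic_pairs; apply/seteqP; split; last first.
    by move=> _ [i _ <-]; exact: dic_pairs_qrot.
  move=> _ [e [s [d [t ->]]]].
  pose q := (s %/ a)%Z; pose t1 := t - q * b%:Z.
  have s_lt : (`|(s %% a)%Z| < a)%N.
    by have := ltz_pmod s (_ : 0 < a%:Z); have := modz_ge0 s (_ : a%:Z != 0); lia.
  have t_lt : (`|(t1 %% (2 * b)%N)%Z| < 2 * b)%N.
    have := ltz_pmod t1 (_ : 0 < (2 * b)%N%:Z).
    by have := modz_ge0 t1 (_ : (2 * b)%N%:Z != 0); lia.
  exists (enum_rank ((Ordinal s_lt, e), (Ordinal t_lt, d))) => //.
  rewrite enum_rankK /f /= !gez0_abs ?modz_ge0; try lia.
  rewrite -[RHS](qrot_dic_shift R e _ d _ (- q)) //.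
  have -> : s + - q * a%:Z = (s %% a)%Z by rewrite [X in X + _](divz_eq s a) /q; ring.
  have -> : t + - q * b%:Z = t1 by rewrite /t1; ring.
  rewrite [in RHS](divz_eq t1 (2 * b)%N) addrC PoszM dic_period //.
have -> : (8 * (a * b) = #|{: T}|)%N.
  by rewrite !card_prod !card_ord card_bool; lia.
rewrite H_image card_eq_sym (card_eqr (inj_card_eq _)) ?card_II //.
by move=> i j _ _ /f_inj /enum_val_inj.
Qed.

End TheGroup.

Lemma matrix_group_SO (R : realType) (n : nat) : matrix_group (SO R n).
Proof.
split.
- by move=> A [AAT _]; case/mulmx1_unit: AAT.
- by split; [rewrite trmx1 mulmx1 | exact: det1].
- move=> A B [AAT detA] [BBT detB]; split.
    by rewrite trmx_mul mulmxA -(mulmxA A) BBT mulmx1.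
  by rewrite det_mulmx detA detB mulr1.
- move=> A [AAT detA]; have [uA _] := mulmx1_unit AAT.
  have -> : invmx A = A^T by rewrite -[LHS]mulmx1 -AAT mulmxA mulVmx // mul1mx.
  by split; [rewrite trmxK; exact: mulmx1C | rewrite det_tr].
Qed.

Lemma subgroup_H_SO (R : realType) (a b : nat) : (0 < a)%N -> (0 < b)%N ->
  subgroup (H_ R a b) (SO R 4).
Proof.
move=> a0 b0; split; [exact: matrix_group_H | exact: matrix_group_SO |].
rewrite H_dic_pairs // => _ [e [s [d [t ->]]]].
by apply: qrot_SO; exact: dic_unit.
Qed.

(** If [b' = b c] then [e_b = e_b' ^ c]. *)
Lemma subgroup_H_dvd (R : realType) (a b b' : nat) :
  (0 < a)%N -> (0 < b)%N -> (0 < b')%N -> (b %| b')%N ->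
  subgroup (H_ R a b) (H_ R a b').
Proof.
move=> a0 b0 b'0 /dvdnP[c b'E]; split; [exact: matrix_group_H.. |].
rewrite !H_dic_pairs // => _ [e [s [d [t ->]]]].
have -> : dic R b d t = dic R b' d (t * c%:Z); last exact: dic_pairs_qrot.
have c0 : c%:R != 0 :> R by rewrite pnatr_eq0; lia.
have b_neq0 : b%:R != 0 :> R by rewrite pnatr_eq0; lia.
have angleE : angle R b t = angle R b' (t * c%:Z).
  rewrite /angle b'E natrM intrM -[c%:~R]/(c%:R).
  by field; rewrite c0 b_neq0.
by rewrite /dic angleE.
Qed.

(** * Isotropy groups along an orbit *)

Section ConjugateIsotropy.
Variables (R : realType) (n : nat) (G : set 'M[R]_n).
Hypothesis groupG : matrix_group G.
Implicit Types (A B : 'M[R]_n) (x : 'cV[R]_n) (K : set 'M[R]_n).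

Let G_unit A : G A -> A \in unitmx.
Proof. by case: groupG => unitG _ _ _ /unitG. Qed.

Let G_mul A B : G A -> G B -> G (A *m B).
Proof. by case: groupG => _ _ mulG _; exact: mulG. Qed.

Let G_inv A : G A -> G (invmx A).
Proof. by case: groupG => _ _ _; apply. Qed.

Lemma conjmx_eq1 A B : A \in unitmx -> A *m B *m invmx A = 1%:M -> B = 1%:M.
Proof.
move=> uA conj1; have -> : B = invmx A *m (A *m B *m invmx A) *m A.
  by rewrite !mulmxA mulVmx // mul1mx -mulmxA mulVmx // mulmx1.
by rewrite conj1 mulmx1 mulVmx.
Qed.

Lemma conj_isotropy A x : G A ->
  [set A *m B *m invmx A | B in isotropy_subgroup G x] =
  isotropy_subgroup G (A *m x).
Proof.
move=> GA; have uA := G_unit GA; apply/seteqP; split.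
  move=> _ [B [GB Bx] <-]; split; first by apply: G_mul (G_inv GA); exact: G_mul.
  by rewrite -!mulmxA (mulmxA (invmx A)) mulVmx // mul1mx Bx.
move=> B [GB BAx]; exists (invmx A *m B *m A).
  split; first by apply: G_mul => //; apply: G_mul => //; exact: G_inv.
  by rewrite -!mulmxA BAx mulmxA mulVmx // mul1mx.
by rewrite !mulmxA mulmxV // mul1mx -mulmxA mulmxV // mulmx1.
Qed.

Lemma conjugacy_class_isotropy x :
  conjugacy_class G (isotropy_subgroup G x) =
  [set isotropy_subgroup G (A *m x) | A in G].
Proof.
by apply/seteqP; split=> _ [A GA <-]; exists A => //; rewrite conj_isotropy.
Qed.

Lemma conjugacy_class_orbit A x : G A ->
  conjugacy_class G (isotropy_subgroup G (A *m x)) =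
  conjugacy_class G (isotropy_subgroup G x).
Proof.
move=> GA; rewrite !conjugacy_class_isotropy; apply/seteqP; split=> _ [B GB <-].
  by exists (B *m A); [exact: G_mul | rewrite mulmxA].
exists (B *m invmx A); first by apply: G_mul => //; exact: G_inv.
by rewrite -mulmxA (mulmxA (invmx A)) mulVmx ?mul1mx //; exact: G_unit.
Qed.

(** [A] maps the fixed space of [K] onto that of its conjugate. *)
Lemma dim_Fix_conj A K d : A \in unitmx -> is_subspace_of_dim (Fix K) d ->
  is_subspace_of_dim (Fix [set A *m B *m invmx A | B in K]) d.
Proof.
move=> uA [V FixV dimV]; pose f := linfun (mulmx A : 'cV[R]_n -> 'cV[R]_n).
exists (f @: V)%VS; last first.
  rewrite limg_dim_eq //; apply/eqP; rewrite -subv0; apply/subvP => x.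
  rewrite memv_cap => /andP[_]; rewrite memv_ker lfunE /= memv0 => /eqP Ax0.
  by rewrite -[x]mul1mx -(mulVmx uA) -mulmxA Ax0 mulmx0.
have inV x : Fix K x <-> x \in V by rewrite FixV.
apply/seteqP; split=> x.
  move=> fix_x; apply/memv_imgP; exists (invmx A *m x); last first.
    by rewrite lfunE /= mulmxA mulmxV // mul1mx.
  apply/inV => B KB; rewrite -[in RHS](fix_x (A *m B *m invmx A)); last by exists B.
  by rewrite !mulmxA mulVmx // mul1mx.
move=> /memv_imgP[y /inV fix_y ->] _ [B KB <-].
by rewrite lfunE /= -!mulmxA (mulmxA (invmx A)) mulVmx // mul1mx fix_y.
Qed.

End ConjugateIsotropy.

Lemma plane_dim (R : realType) (n : nat) (u v : 'cV[R]_n) :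
  (forall c d : R, c *: u + d *: v = 0 -> c = 0 /\ d = 0) ->
  is_subspace_of_dim [set x | exists c d, x = c *: u + d *: v] 2.
Proof.
move=> free_uv; exists (<[u]> + <[v]>)%VS.
  apply/seteqP; split=> x.
    by move=> [c [d ->]]; apply: memv_add; apply/vlineP; [exists c | exists d].
  by move=> /memv_addP[_ /vlineP[c ->] [_ /vlineP[d ->] ->]]; exists c, d.
have u0 : u != 0.
  apply/eqP => u0; case: (free_uv 1 0); first by rewrite u0 scaler0 scale0r addr0.
  by move=> /eqP; rewrite oner_eq0.
have v0 : v != 0.
  apply/eqP => v0; case: (free_uv 0 1); first by rewrite v0 scaler0 scale0r addr0.
  by move=> _ /eqP; rewrite oner_eq0.
rewrite dimv_disjoint_sum ?dim_vline ?u0 ?v0 //.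
apply/eqP; rewrite -subv0; apply/subvP => x; rewrite memv_cap memv0.
move=> /andP[/vlineP[c ->] /vlineP[d cd]].
have [|-> _] := free_uv c (- d); last by rewrite scale0r.
by rewrite cd scaleNr subrr.
Qed.

(** * Isotropy types of the group *)

Section Isotropy.
Variables (R : realType) (a b : nat).
Hypotheses (a_gt0 : (0 < a)%N) (b_gt0 : (0 < b)%N).
Hypotheses (a_odd : odd a) (b_odd : odd b) (ab_coprime : coprime a b).
Local Notation H := 'cV[R]_4.
Local Notation G := (H_ R a b).
Implicit Types (x y : H) (A M N : 'M[R]_4).

Lemma odd_not_double (p : nat) (n : int) : odd p ->
  ~ ((2 * p)%N%:Z %| n + n - p%:Z)%Z.
Proof. by move=> p_odd /dvdzP[q]; rewrite PoszM mulrCA => E; lia. Qed.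

Lemma dvdz_cancel_coprime (p q : nat) (n : int) : coprime p q ->
  ((2 * q)%N%:Z %| (2 * p)%N%:Z * n)%Z -> (q%:Z %| n)%Z.
Proof.
move=> pq; rewrite !PoszM -mulrA dvdz_mul2l // Gauss_dvdzr //.
by rewrite coprimezE coprime_sym.
Qed.

(** If [l = e_a^s] and [r = e_b^t] satisfy [l x = x r], then [2 a]-th powers give
    [x = x r^(2 a)], so [b] divides [a t], hence [t]; likewise [a] divides [s].
    Then [l] and [r] are signs, and equal ones because [x] is not [0]. *)
Lemma cyclic_fix s t x : x <> 0 ->
  qrot (dic R a false s) (dic R b false t) *m x = x ->
  qrot (dic R a false s) (dic R b false t) = 1%:M.
Proof.
move=> x0 fix1.
have fixk (k : nat) :
    qrot (dic R a false (k%:Z * s)) (dic R b false (k%:Z * t)) *m x = x.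
  elim: k => [|k IH]; first by rewrite !mul0r !dic0 qrot1 mul1mx.
  rewrite intS !mulrDl !mul1r.
  have := dicM R false s false (k%:Z * s) a_gt0; rewrite /= addr0 => <-.
  have := dicM R false t false (k%:Z * t) b_gt0; rewrite /= addr0 => <-.
  by rewrite -qrotM -mulmxA IH.
have kill p n : (0 < p)%N -> dic R p false ((2 * p)%N%:Z * n) = q1 R.
  move=> p0; have := dic_period R false 0 n p0; rewrite add0r dic0 => <-.
  by congr dic; rewrite PoszM; ring.
have b_dvd_t : (b%:Z %| t)%Z.
  have := fixk (2 * a)%N; rewrite kill // => /(qrot_fix_re (dic_unit _ _ _ _) x0).
  rewrite /dic !quatE => /esym /cos_angle_eq1; move/(_ b_gt0).
  exact: dvdz_cancel_coprime.
have a_dvd_s : (a%:Z %| s)%Z.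
  have := fixk (2 * b)%N; rewrite [dic R b _ _]kill //.
  move=> /(qrot_fix_re (qunit1 R) x0).
  rewrite /dic !quatE => /cos_angle_eq1; move/(_ a_gt0).
  by apply: dvdz_cancel_coprime; rewrite coprime_sym.
move: fix1; case/dvdzP: b_dvd_t => t1 ->; case/dvdzP: a_dvd_s => s1 ->.
have -> : qrot (dic R a false (s1 * a%:Z)) (dic R b false (t1 * b%:Z)) =
   qrot (dic R a false ((s1 - t1) * a%:Z)) (q1 R).
  rewrite -(dic0 R b) -[RHS](qrot_dic_shift R _ _ _ _ t1) // add0r.
  by congr (qrot (dic _ _ _ _) _); ring.
move=> /(qrot_fix_re (qunit1 R) x0); rewrite {1}/dic !quatE => /dic_eq1 E.
by rewrite E qrot1.
Qed.

(** If exactly one factor is in the coset of [j], say [r], then [r^2 = -1], so by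
    [cyclic_fix] the square of [qrot l r] fixes [x] only if [l^2 = -1]; but
    [-1 = e_a^a] with [a] odd is not an even power of [e_a], whose order is
    [2 a]. *)
Lemma H_fix M x : G M -> x <> 0 -> M *m x = x ->
  M = 1%:M \/ exists s t, M = qrot (dic R a true s) (dic R b true t).
Proof.
have minus1 p : (0 < p)%N -> dic R p false p = - q1 R.
  by move=> p0; rewrite -[p%:Z]add0r dic_add_half // dic0.
have j_sq p n : (0 < p)%N -> dic R p false (n - n + p%:Z) = - q1 R.
  by move=> p0; rewrite subrr add0r minus1.
have no_root p n : (0 < p)%N -> odd p -> dic R p false (n + n + 0) <> - q1 R.
  move=> p0 p_odd; rewrite -(minus1 p) // addr0 => /dic_inj[] // _.
  exact: odd_not_double.
rewrite H_dic_pairs // => -[e [s [d [t ->]]]] x0 fixM.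
have fix2 :
    qrot (dic R a e s) (dic R b d t) *m qrot (dic R a e s) (dic R b d t) *m x = x.
  by rewrite -mulmxA !fixM.
move: fix2; rewrite qrotM !dicM //; case: e d fixM => -[] /= fixM.
- by right; exists s, t.
- move=> /(cyclic_fix x0) /qrot_eq1[||lr _]; try exact: dic_unit.
  by case: (no_root b t) => //; rewrite -lr j_sq.
- move=> /(cyclic_fix x0) /qrot_eq1[||lr _]; try exact: dic_unit.
  by case: (no_root a s) => //; rewrite lr j_sq.
- by left; exact: cyclic_fix fixM.
Qed.

(** The product of two elements outside the cyclic part has powers of [e_a] and
    [e_b] as factors, so [cyclic_fix] makes it trivial. Applied to [M M] and
    [N M], this gives [N = M^-1 = M]. *)
Lemma isotropy_unique M N x : x <> 0 ->
  isotropy_subgroup G x M -> isotropy_subgroup G x N ->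
  M <> 1%:M -> N <> 1%:M -> M = N.
Proof.
move=> x0 [GM Mx] [GN Nx] M1 N1.
case: (H_fix GM x0 Mx) => // -[s [t ME]]; case: (H_fix GN x0 Nx) => // -[s' [t' NE]].
have prod1 u v u' v' :
    qrot (dic R a true u) (dic R b true v) *m x = x ->
    qrot (dic R a true u') (dic R b true v') *m x = x ->
    qrot (dic R a true u) (dic R b true v) *m
    qrot (dic R a true u') (dic R b true v') = 1%:M.
  move=> fix1 fix2.
  have := congr1 (mulmx (qrot (dic R a true u) (dic R b true v))) fix2.
  rewrite fix1 mulmxA qrotM !dicM //=; exact: cyclic_fix.
have MM : M *m M = 1%:M by rewrite ME in Mx *; exact: prod1.
have NM : N *m M = 1%:M by rewrite ME in Mx *; rewrite NE in Nx *; exact: prod1.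
by rewrite -[M]mul1mx -NM -mulmxA MM mulmx1.
Qed.

Lemma isotropy_eq M x y : x <> 0 -> y <> 0 -> M <> 1%:M ->
  isotropy_subgroup G x M -> isotropy_subgroup G y M ->
  isotropy_subgroup G x = isotropy_subgroup G y.
Proof.
move=> x0 y0 M1 xM yM.
have incl u v : u <> 0 -> isotropy_subgroup G u M -> isotropy_subgroup G v M ->
    isotropy_subgroup G u `<=` isotropy_subgroup G v.
  move=> u0 uM vM N uN; have [->|N1] := pselect (N = 1%:M).
    by case: (matrix_group_H R a_gt0 b_gt0) => _ G1 _ _; split; rewrite ?mul1mx.
  by rewrite -(isotropy_unique u0 uM uN).
by apply/seteqP; split; apply: incl.
Qed.

(** The two involutions [x |-> j x j^*] and [x |-> - j x j^*]: they represent the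
    conjugacy classes of nontrivial group elements with a nonzero fixed vector. *)
Definition flip (c : bool) : 'M[R]_4 :=
  if c then qrot (qj R) (- qj R) else qrot (qj R) (qj R).

(** A point fixed by [flip c], where the isotropy type of [flip c] is realised. *)
Definition axis (c : bool) : H := if c then qi R else q1 R.

Lemma flip_dic c :
  flip c = qrot (dic R a true 0) (dic R b true (if c then b%:Z else 0)).
Proof.
rewrite /flip; case: c; rewrite ?dic_j //.
by rewrite -[b%:Z]add0r dic_add_half // dic_j.
Qed.

Lemma flip_neq1 c : flip c <> 1%:M.
Proof.
rewrite flip_dic => /qrot_eq1[||_]; try exact: dic_unit.
by rewrite -(dic0 R a) -dic_add_half // => -[] /dic_inj[].
Qed.

Lemma axis_neq0 c : axis c <> 0.
Proof.
move=> /(congr1 (@qnorm2 R)); rewrite /axis /qnorm2.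
case: c; rewrite !quatE !mxE => /eqP;
by rewrite !expr0n !expr1n !addr0 ?add0r oner_eq0.
Qed.

Lemma qunit_j : qunit (qj R).
Proof. by rewrite -(dic_j R 1); exact: dic_unit. Qed.

Lemma flip_fix c x : flip c *m x = x <->
  exists u v, x = if c then u *: qi R + v *: qk R else u *: q1 R + v *: qj R.
Proof.
have uj := qunit_j.
have -> : flip c *m x = x <->
    qmul (qj R) x = (if c then - qmul x (qj R) else qmul x (qj R)).
  rewrite /flip; case: c; rewrite -?qmulNr; apply: qrot_fix => //.
  by rewrite /qunit qconjN qmulNl qmulNr opprK.
have -> : qmul (qj R) x = quat (- x 2 0) (x 3 0) (x 0 0) (- x 1 0).
  by rewrite /qmul /qj !quatE; congr quat; ring.
have -> : qmul x (qj R) = quat (- x 2 0) (- x 3 0) (x 0 0) (x 1 0).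
  by rewrite /qmul /qj !quatE; congr quat; ring.
case: c; rewrite ?quatN ?opprK; split.
- move=> /quat_inj[x2 _ x0 _]; exists (x 1 0), (x 3 0).
  by rewrite [LHS]quat_eta /qi /qk !quatZ quatD; congr quat; lra.
- by case=> u [v ->]; rewrite /qi /qk !quatZ quatD !quatE; congr quat; ring.
- move=> /quat_inj[_ x3 _ x1]; exists (x 0 0), (x 2 0).
  by rewrite [LHS]quat_eta /q1 /qj !quatZ quatD; congr quat; lra.
- by case=> u [v ->]; rewrite /q1 /qj !quatZ quatD !quatE; congr quat; ring.
Qed.

Lemma dim_Fix_flip c : is_subspace_of_dim (Fix [set M | M = 1%:M \/ M = flip c]) 2.
Proof.
pose u := if c then qi R else q1 R; pose v := if c then qk R else qj R.
have -> : Fix [set M | M = 1%:M \/ M = flip c] =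
    [set x | exists k l, x = k *: u + l *: v].
  rewrite /u /v; apply/seteqP; split=> x.
    move=> /(_ (flip c) (or_intror erefl)) /flip_fix[k [l xE]].
    by exists k, l; rewrite xE; case: (c).
  move=> [k [l xE]] _ [->|->]; first by rewrite mul1mx.
  by apply/flip_fix; exists k, l; rewrite xE; case: (c).
apply: plane_dim => k l; rewrite /u /v -[0 in RHS](scale0r (q1 R)).
by case: c {u v}; rewrite /q1 /qi /qj /qk !quatZ quatD => /quat_inj[]; lra.
Qed.

(** Conjugation by [qrot (e_a^m) (e_b^n)] adds [2 m] and [2 n] to the exponents, so
    both can be brought to [0] or, [a] and [b] being odd, to a half turn. *)
Lemma flip_conj s t : exists2 A, G A & exists c,
  A *m qrot (dic R a true s) (dic R b true t) *m invmx A = flip c.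
Proof.
have half p (n : int) : odd p -> exists m, n + 2 * m = 0 \/ n + 2 * m = p%:Z.
  move=> p_odd; have [n_even|n_odd] := boolP (2 %| n)%Z.
    by case/dvdzP: n_even => q ->; exists (- q); left; ring.
  have /dvdzP[q nq] : (2 %| p%:Z - n)%Z by lia.
  by exists q; right; lia.
have [m hm] := half a s a_odd; have [n hn] := half b t b_odd.
exists (qrot (dic R a false m) (dic R b false n)).
  by rewrite H_dic_pairs //; exact: dic_pairs_qrot.
rewrite invmx_qrot; try exact: dic_unit.
rewrite !dicC // !qrotM !dicM //=.
have -> : m + s + 0 - - m + 0 = s + 2 * m by ring.
have -> : n + t + 0 - - n + 0 = t + 2 * n by ring.
have half_j p : (0 < p)%N -> dic R p true p = - qj R.
  by move=> p0; rewrite -[p%:Z]add0r dic_add_half // dic_j.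
case: hm hn => -> [] ->; rewrite !(dic_j, half_j) //.
- by exists false.
- by exists true.
- by exists true; rewrite -qrotNN opprK.
- by exists false; rewrite qrotNN.
Qed.

(** A conjugate of [flip false] by a group element has the form
    [qrot (e_a^(2 m) j) (e_b^(2 n) j)]. For [flip true] exactly one exponent has to be an odd half turn, up to a common
    sign; as [a] and [b] are odd, this is impossible with even exponents. *)
Lemma flip_not_conj A : G A -> A *m flip false *m invmx A <> flip true.
Proof.
rewrite H_dic_pairs // => -[e [s [d [t ->]]]].
rewrite !flip_dic invmx_qrot; try exact: dic_unit.
have conj_j p e' n : (0 < p)%N ->
    exists m, qmul (qmul (dic R p e' n) (dic R p true 0)) (qconj (dic R p e' n)) =
              dic R p true (m + m).
  move=> p0; rewrite dicC // !dicM //; case: e' => /=.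
    by exists (n + p%:Z); congr dic; ring.
  by exists n; congr dic; ring.
rewrite !qrotM; have [m ->] := conj_j a e s a_gt0; have [n ->] := conj_j b d t b_gt0.
move=> /qrot_inj[||||[_]|[+ _]]; try exact: dic_unit.
  by move=> /dic_inj[] // _; exact: odd_not_double.
by rewrite -dic_add_half // => /dic_inj[] // _; rewrite add0r; exact: odd_not_double.
Qed.

Lemma isotropy_axis c : isotropy_subgroup G (axis c) (flip c).
Proof.
split.
  by rewrite flip_dic H_dic_pairs //; exact: dic_pairs_qrot.
apply/flip_fix; exists 1, 0; rewrite /axis.
by case: c; rewrite scale1r scale0r addr0.
Qed.

Lemma isotropy_axisE c :
  isotropy_subgroup G (axis c) = [set M | M = 1%:M \/ M = flip c].
Proof.
apply/seteqP; split=> M.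
  move=> axisM; have [|M1] := pselect (M = 1%:M); first by left.
  right; apply: (isotropy_unique (@axis_neq0 c) axisM (isotropy_axis c)) => //.
  exact: flip_neq1.
case=> ->; last exact: isotropy_axis.
by case: (matrix_group_H R a_gt0 b_gt0) => _ G1 _ _; split; rewrite ?mul1mx.
Qed.

Local Notation axis_type c := (conjugacy_class G (isotropy_subgroup G (axis c))).

Lemma axis_type_inj : axis_type false <> axis_type true.
Proof.
have groupG := matrix_group_H R a_gt0 b_gt0.
case: (groupG) => unitG G1 _ _ E.
have : axis_type true (isotropy_subgroup G (axis true)).
  by rewrite conjugacy_class_isotropy //; exists 1%:M; rewrite ?mul1mx.
rewrite -E => -[A GA] AE; apply: (flip_not_conj GA).
apply: (isotropy_unique (@axis_neq0 true)).
- by rewrite -AE; exists (flip false) => //; exact: isotropy_axis.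
- exact: isotropy_axis.
- by move=> /(conjmx_eq1 (unitG _ GA)); exact: flip_neq1.
- exact: flip_neq1.
Qed.

Lemma H_N1 : G (- 1%:M).
Proof.
rewrite -qrot1 -qrotNr -{1}(dic0 R a) -(dic0 R b) -dic_add_half // H_dic_pairs //.
exact: dic_pairs_qrot.
Qed.

Lemma N1_fix x : (- 1%:M) *m x = x -> x = 0.
Proof.
rewrite mulNmx mul1mx => Nx; have : x + x = 0 by rewrite -{1}Nx addNr.
by rewrite -mulr2n -scaler_nat => /eqP; rewrite scaler_eq0 pnatr_eq0 => /eqP.
Qed.

Lemma nontrivial_isotropy_typesE :
  nontrivial_isotropy_types G = [set axis_type c | c in [set: bool]].
Proof.
have groupG := matrix_group_H R a_gt0 b_gt0; case: (groupG) => unitG G1 _ _.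
apply/seteqP; split.
  move=> _ [[x _ <-] nontriv].
  have [K1 KG] : isotropy_subgroup G x <> [set 1%:M] /\ isotropy_subgroup G x <> G.
    apply: nontriv; rewrite conjugacy_class_isotropy //.
    by exists 1%:M; rewrite ?mul1mx.
  have x0 : x <> 0.
    move=> x0; apply: KG; apply/seteqP; split=> M; first by case.
    by move=> GM; split; rewrite // x0 mulmx0.
  have [M [GM Mx] M1] : exists2 M, isotropy_subgroup G x M & M <> 1%:M.
    apply: contrapT => no_M; apply: K1; apply/seteqP; split=> M.
      by move=> xM; apply: contrapT => M1; apply: no_M; exists M.
    by move=> ->; split; rewrite ?mul1mx.
  case: (H_fix GM x0 Mx) => // -[s [t ME]].
  have [A GA [c AE]] := flip_conj s t; rewrite -ME in AE.
  exists c => //; rewrite -(conjugacy_class_orbit groupG x GA).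
  congr (conjugacy_class G _); apply: (@isotropy_eq (flip c)).
  - exact: axis_neq0.
  - move=> Ax0; apply: x0; rewrite -[x]mul1mx -(mulVmx (unitG _ GA)) -mulmxA Ax0.
    by rewrite mulmx0.
  - exact: flip_neq1.
  - exact: isotropy_axis.
  - by rewrite -conj_isotropy // -AE; exists M.
move=> _ [c _ <-]; split; first by exists (axis c).
rewrite conjugacy_class_isotropy // => _ [A GA <-].
have uA := unitG _ GA; rewrite -conj_isotropy //; split=> E.
  apply: (@flip_neq1 c).
  have : [set 1%:M] (A *m flip c *m invmx A).
    by rewrite -E; exists (flip c) => //; exact: isotropy_axis.
  exact: conjmx_eq1.
apply: (@axis_neq0 c); move: H_N1; rewrite -[X in X _]E conj_isotropy //.
move=> [_ /N1_fix Ax0]; rewrite -[axis c]mul1mx -(mulVmx uA) -mulmxA Ax0.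
by rewrite mulmx0.
Qed.

Lemma card_nontrivial_isotropy_types : nontrivial_isotropy_types G #= `I_2.
Proof.
rewrite nontrivial_isotropy_typesE.
have -> : [set axis_type c | c in [set: bool]] =
    [set axis_type (i != 0) | i in [set: 'I_2]].
  apply/seteqP; split=> _ [c _ <-]; last by exists (c != 0).
  by exists (if c then 1 else 0) => //; case: c.
rewrite card_eq_sym (card_eqr (inj_card_eq _)) ?card_II //.
move=> i j _ _; case: (eqVneq i 0) (eqVneq j 0) => [->|i0] [->|j0] //=.
- by move/axis_type_inj.
- by move/esym/axis_type_inj.
- by move=> _; apply/val_inj; case: i j i0 j0 => [[|[|[]]]] // ? [[|[|[]]]].
Qed.

Lemma dim_Fix_nontrivial T K :
  nontrivial_isotropy_types G T -> T K -> is_subspace_of_dim (Fix K) 2.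
Proof.
rewrite nontrivial_isotropy_typesE => -[c _ <-] [A GA <-].
have [unitG _ _ _] := matrix_group_H R a_gt0 b_gt0.
apply: dim_Fix_conj; first exact: unitG.
by rewrite isotropy_axisE; exact: dim_Fix_flip.
Qed.

End Isotropy.

(** * Absolute irreducibility *)

Lemma qcentral_real (R : realType) (q : 'cV[R]_4) :
  qmul (qi R) q = qmul q (qi R) -> qmul (qj R) q = qmul q (qj R) ->
  q = q 0 0 *: q1 R.
Proof.
rewrite [q]quat_eta; move: (q 0 0) (q 1 0) (q 2 0) (q 3 0) => c x y z.
rewrite /qmul /qi /qj !quatE => /quat_inj[_ _ i3 i4] /quat_inj[_ j2 _ j4].
by rewrite /q1 quatZ; congr quat; lra.
Qed.

(** A linear map commuting with left multiplication by [e_a = cos + i sin], where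
    [sin != 0], commutes with left multiplication by [i]. Thus it commutes with
    left multiplication by [i] and [j], hence is right multiplication by its value
    [q] at [1]; commuting with right multiplications too, [q] is central. *)
Lemma abs_irreducible_H (R : realType) (a b : nat) : (1 < a)%N -> (1 < b)%N ->
  abs_irreducible (H_ R a b).
Proof.
move=> a1 b1 f f_comm; have a0 := ltnW a1; have b0 := ltnW b1.
have gen e s d t x : f (qmul (qmul (dic R a e s) x) (qconj (dic R b d t))) =
    qmul (qmul (dic R a e s) (f x)) (qconj (dic R b d t)).
  by rewrite -!qrotE f_comm // H_dic_pairs //; exact: dic_pairs_qrot.
have genl e s x : f (qmul (dic R a e s) x) = qmul (dic R a e s) (f x).
  by have := gen e s false 0 x; rewrite dic0 qconj1 !qmul1r.
have genr d t x : f (qmul x (dic R b d t)) = qmul (f x) (dic R b d t).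
  have [d' [t' <-]] : exists d' t', qconj (dic R b d' t') = dic R b d t.
    by exists d; rewrite -[dic R b d t]qconjK (dicC R d) //; eexists.
  by have := gen false 0 d' t' x; rewrite dic0 !qmul1l.
have sin_neq0 p : (1 < p)%N -> sin (angle R p 1) != 0.
  move=> p1; rewrite /angle mul1r gt_eqF // sin_gt0_pi //.
  rewrite divr_gt0 ?pi_gt0 ?ltr0n //=; last lia.
  by rewrite ltr_pdivrMr ?ltr0n; [rewrite ltr_pMr ?pi_gt0 // ltr1n | lia].
have e_l p x : qmul (dic R p false 1) x =
    cos (angle R p 1) *: x + sin (angle R p 1) *: qmul (qi R) x.
  rewrite [X in _ *: X + _]quat_eta /dic /qi /qmul !quatE !quatZ quatD.
  by congr quat; ring.
have e_r p x : qmul x (dic R p false 1) =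
    cos (angle R p 1) *: x + sin (angle R p 1) *: qmul x (qi R).
  rewrite [X in _ *: X + _]quat_eta /dic /qi /qmul !quatE !quatZ quatD.
  by congr quat; ring.
have fil x : f (qmul (qi R) x) = qmul (qi R) (f x).
  have := genl false 1 x; rewrite !e_l linearD !linearZ /= => /addrI.
  exact/scalerI/sin_neq0.
have fir x : f (qmul x (qi R)) = qmul (f x) (qi R).
  have := genr false 1 x; rewrite !e_r linearD !linearZ /= => /addrI.
  exact/scalerI/sin_neq0.
have fjl x : f (qmul (qj R) x) = qmul (qj R) (f x).
  by have := genl true 0 x; rewrite dic_j.
have fjr x : f (qmul x (qj R)) = qmul (f x) (qj R).
  by have := genr true 0 x; rewrite dic_j.
have fi : f (qi R) = qmul (qi R) (f (q1 R)) by rewrite -fil qmul1r.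
have fj : f (qj R) = qmul (qj R) (f (q1 R)) by rewrite -fjl qmul1r.
have f1 : f (q1 R) = f (q1 R) 0 0 *: q1 R.
  by apply: qcentral_real; [rewrite -fil -fir | rewrite -fjl -fjr];
     rewrite qmul1l qmul1r.
exists (f (q1 R) 0 0) => x; move: f1; set c := f (q1 R) 0 0 => f1.
have qmulZ l : qmul l (c *: q1 R) = c *: l.
  rewrite [X in _ = _ *: X]quat_eta /q1 quatZ /qmul !quatE quatZ; congr quat; ring.
have fk : f (qk R) = c *: qk R by rewrite -qmul_ij fil fj f1 qmulA qmulZ.
have xE : x = x 0 0 *: q1 R + x 1 0 *: qi R + x 2 0 *: qj R + x 3 0 *: qk R.
  rewrite [LHS]quat_eta /q1 /qi /qj /qk !quatZ !quatD; congr quat; ring.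
(* [linearZ] also distributes the scaling by [c] on the right-hand side. *)
rewrite xE !linearD !linearZ /= fk fi fj f1 !qmulZ.
by rewrite !scalerA.
Qed.

(** * Order, inclusions and isotropy types *)

Theorem theorem1p2 (R : realType) :
  (forall m a b : nat,
     odd m -> m = (a * b)%N ->
     (3 <= a)%N -> (3 <= b)%N -> odd a -> odd b -> coprime a b ->
     subgroup (H_ R a b) (SO R 4) /\ H_ R a b #= `I_(8 * m)) /\
  (forall a b b' : nat,
     (3 <= a)%N -> (3 <= b)%N -> odd a -> odd b -> coprime a b ->
     (b < b')%N -> odd b' -> coprime a b' -> (b %| b')%N ->
     subgroup (H_ R a b) (H_ R a b')) /\
  (forall a b : nat,
     (3 <= a)%N -> (3 <= b)%N -> odd a -> odd b -> coprime a b ->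
     [/\ abs_irreducible (H_ R a b),
         nontrivial_isotropy_types (H_ R a b) #= `I_2
       & forall T, nontrivial_isotropy_types (H_ R a b) T ->
         forall K, T K -> is_subspace_of_dim (Fix K) 2]).
Proof.
have pos n : (3 <= n)%N -> (0 < n)%N by lia.
split; [|split].
- move=> m a b _ -> /pos a0 /pos b0 _ _ _.
  by split; [exact: subgroup_H_SO | exact: card_H].
- move=> a b b' /pos a0 /pos b0 _ _ _ b_lt _ _ b_dvd.
  by apply: subgroup_H_dvd => //; lia.
- move=> a b a3 b3 a_odd b_odd ab; have a0 := pos _ a3; have b0 := pos _ b3.
  split; [by apply: abs_irreducible_H; lia | exact: card_nontrivial_isotropy_types |].
  by move=> T hT K; exact: dim_Fix_nontrivial hT.
Qed.
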